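(* Let $\Sigma_\theta^{-1}$ be the inverse covariance matrix of the nodal phase angles in a radial grid $\mathcal G$ under the DC power flow model with Gaussian nodal injection fluctuations. For distinct non-reference buses $i,j$, if $\Sigma_\theta^{-1}(i,j)<0$, then $(ij)$ is an edge of $\mathcal G$.
   Context: Power grid: a finite connected simple undirected graph with $N$ non-reference buses and one reference bus; it is radial if it has no cycles. Each line $(ij)$ has susceptance $\beta_{ij}=\beta_{ji}>0$. Reduced weighted Laplacian $H_\beta\in\mathbb R^{N\times N}$ (indexed by non-reference buses): $H_\beta(i,i)=\sum_k\beta_{ik}$ (sum over all lines at $i$, including a line to the reference bus), $H_\beta(i,j)=-\beta_{ij}$ if $(ij)$ is a line between distinct non-reference buses, and $0$ otherwise. $H_\beta$ is invertible. DC power flow model: $p=H_\beta\theta$, with $p\sim\mathcal N(0,\Sigma_p)$ the active injections at non-reference buses, $\Sigma_p$ diagonal with positive diagonal entries (independent non-degenerate injections), and $\theta$ the phase angles; so $\theta\sim\mathcal N(0,\Sigma_\theta)$ with $\Sigma_\theta=H_\beta^{-1}\Sigma_pH_\beta^{-1}$. *)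

(* Defs.v *)
From HB Require Import structures.
From mathcomp Require Import all_boot all_order all_algebra.
From mathcomp Require Import all_classical all_reals all_analysis.

Set Implicit Arguments.
Unset Strict Implicit.
Unset Printing Implicit Defensive.

Import Order.TTheory GRing.Theory Num.Theory.

Local Open Scope classical_set_scope.
Local Open Scope ring_scope.

(* [Some i] is the i-th non-reference bus and [None] is the reference bus. *)
Notation bus N := (option 'I_N).

(* [beta] is meaningful only on lines; its values elsewhere are never used. *)
Record power_grid (R : realType) (N : nat) := PowerGrid {
  line : rel (bus N) ;
  beta : bus N -> bus N -> R ;
  line_sym : symmetric line ;
  line_irr : irreflexive line ;
  line_connected : forall x y : bus N, connect line x y ;
  beta_sym : forall x y : bus N, line x y -> beta x y = beta y x ;
  beta_gt0 : forall x y : bus N, line x y -> 0 < beta x y }.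

(* [ucycle] also accepts sequences of length 2 (a line traversed back and
   forth), which are not cycles of a simple graph. *)
Definition radial (R : realType) (N : nat) (G : power_grid R N) : Prop :=
  forall c : seq (bus N), (2 < size c)%N -> ~ ucycle (line G) c.

Definition reduced_laplacian (R : realType) (N : nat) (G : power_grid R N)
    : 'M[R]_N :=
  \matrix_(i, j)
    if i == j then \sum_(k : bus N | line G (Some i) k) beta G (Some i) k
    else if line G (Some i) (Some j) then - beta G (Some i) (Some j)
    else 0.

(* The second parameter is the variance, whereas [normal_prob] expects the
   standard deviation.  [normal_prob m 0] is a uniform law, so the degenerate
   case needs a Dirac mass. *)
Definition gaussian_law (R : realType) (m v : R) : set R -> \bar R :=
  if 0 < v then normal_prob m (Num.sqrt v) else dirac m.

(* X ~ N(mu, Sigma), degenerate Sigma allowed: Sigma is symmetric positive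
   semidefinite and every linear combination a^T X has the univariate Gaussian
   law of mean a^T mu and variance a^T Sigma a. *)
Definition gaussian_vector (d : measure_display) (T : measurableType d)
    (R : realType) (P : probability T R) (n : nat)
    (X : 'I_n -> {RV P >-> R}) (mu : 'cV[R]_n) (Sigma : 'M[R]_n) : Prop :=
  Sigma^T = Sigma /\
  forall a : 'cV[R]_n,
    let v := (a^T *m Sigma *m a) 0 0 in
    0 <= v /\
    forall A : set R, measurable A ->
      P [set w | A (\sum_(i < n) a i 0 * X i w)] =
      gaussian_law ((a^T *m mu) 0 0) v A.

(* [fine] is harmless for square-integrable components, whose covariances are
   finite; an infinite covariance would be read as 0. *)
Definition covariance_mx (d : measure_display) (T : measurableType d)
    (R : realType) (P : probability T R) (n : nat)
    (X : 'I_n -> {RV P >-> R}) : 'M[R]_n :=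
  \matrix_(i, j) fine (covariance P (X i) (X j)).

Definition dc_power_flow (d : measure_display) (T : measurableType d)
    (R : realType) (P : probability T R) (N : nat) (G : power_grid R N)
    (p theta : 'I_N -> {RV P >-> R}) : Prop :=
  forall w : T,
    \col_i p i w = reduced_laplacian G *m \col_i theta i w.

(* Main.v *)
(** Write H for the reduced Laplacian.  It is invertible by the maximum
    principle, so theta = H^-1 p.  After normalisation, every linear combination
    of p has the law N(0, 1), so its variance is c a^T Sigma_p a, where
    0 <= c < oo is the variance of N(0, 1) (its value 1 is never needed), and
    polarisation gives Cov(theta) = c H^-1 Sigma_p H^-T.  If c = 0 this matrix
    and its [invmx] vanish; otherwise the (i, j) entry of the inverse is
    c^-1 sum_k H_ki H_kj / Sigma_p(k, k).  Off-diagonal entries of H are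
    nonpositive, so only the summands k = i and k = j can be negative, and
    these contain the factor H_ij or H_ji, which vanishes off the lines. *)

Require Import Defs.
From mathcomp Require Import all_boot all_order all_algebra.
From mathcomp Require Import all_classical all_reals all_analysis.
From mathcomp Require Import measurable_realfun ring lra.

Set Implicit Arguments.
Unset Strict Implicit.
Unset Printing Implicit Defensive.

Import Order.TTheory GRing.Theory Num.Theory.

Local Open Scope classical_set_scope.
Local Open Scope ring_scope.

(** * Invertibility and sign pattern of the reduced Laplacian *)

Definition grounded (R : realType) (N : nat) (x : 'cV[R]_N) (b : bus N) : R :=
  if b is Some i then x i 0 else 0.

(** With the reference bus held at potential 0, a line to it enters the product only through the
    diagonal entry, so each row becomes a balance of flows. *)
Lemma reduced_laplacian_mulE (R : realType) (N : nat) (G : power_grid R N)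
    (x : 'cV[R]_N) (i : 'I_N) :
  (reduced_laplacian G *m x) i 0 =
  \sum_(k : bus N | line G (Some i) k)
    beta G (Some i) k * (grounded x (Some i) - grounded x k).
Proof.
under [RHS]eq_bigr do rewrite mulrBr.
rewrite sumrB -mulr_suml mxE (bigD1 i) //= mxE eqxx; congr (_ + _).
rewrite [X in - X]big_mkcond (bigID (pred1 (None : bus N)))/= big_pred1_eq.
rewrite mulr0 if_same add0r.
rewrite (reindex_omap (Some : 'I_N -> bus N) id)/=; last by case.
rewrite [X in - X](bigD1 i) ?eqxx//= line_irr add0r -sumrN.
apply: eq_big => [j|j ji]; first by rewrite eqxx.
rewrite mxE eq_sym (negbTE ji); case: ifP => _; last by rewrite mul0r oppr0.
by rewrite mulNr.
Qed.

(* Maximum principle: at a bus where the potential is maximal, the balance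
   equation forces all neighbours to have the same potential. *)
Lemma reduced_laplacian_ker_le0 (R : realType) (N : nat) (G : power_grid R N)
    (x : 'cV[R]_N) : reduced_laplacian G *m x = 0 -> forall i, x i 0 <= 0.
Proof.
move=> Hx0 i.
have [/= m _ mmax] := @arg_maxP _ _ _ (None : bus N) xpredT (grounded x) isT.
suff ym0 : grounded x m <= 0 by exact: le_trans (mmax (Some i) isT) ym0.
rewrite leNgt; apply/negP => ym_gt0.
have clos : closed_mem (line G) (mem [pred b | grounded x b == grounded x m]).
  apply: (intro_closed (sym_connect_sym (@line_sym _ _ G))) => a b ab.
  rewrite !inE => /eqP ya; case: a ya ab => [a|] ya ab; last first.
    by rewrite -ya /= ltxx in ym_gt0.
  have := reduced_laplacian_mulE G x a; rewrite Hx0 mxE => /esym s0.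
  have flow_ge0 k : line G (Some a) k ->
      0 <= beta G (Some a) k * (grounded x (Some a) - grounded x k).
    by move=> ak; rewrite mulr_ge0 ?(ltW (beta_gt0 ak))// subr_ge0 ya mmax.
  have /eqP := psumr_eq0P flow_ge0 s0 ab.
  by rewrite mulf_eq0 gt_eqF ?beta_gt0//= subr_eq0 -ya eq_sym.
(* Connectivity carries the positive maximum to the reference bus, where the potential is 0. *)
have := closed_connect clos (line_connected G m None).
by rewrite !inE eqxx/= => /esym/eqP y0; rewrite -y0 ltxx in ym_gt0.
Qed.

Lemma reduced_laplacian_unit (R : realType) (N : nat) (G : power_grid R N) :
  reduced_laplacian G \in unitmx.
Proof.
rewrite -unitmx_tr -row_free_unit; apply: inj_row_free => v vH0.
have Hv0 : reduced_laplacian G *m v^T = 0.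
  by rewrite -[LHS]trmxK trmx_mul trmxK vH0 trmx0.
(* The one-sided bound, applied to both signs of the kernel vector, forces it to vanish. *)
have HNv0 : reduced_laplacian G *m (- v^T) = 0 by rewrite mulmxN Hv0 oppr0.
apply/rowP => i; apply/eqP; rewrite mxE eq_le.
have := reduced_laplacian_ker_le0 Hv0 i; rewrite mxE => ->.
by have := reduced_laplacian_ker_le0 HNv0 i; rewrite !mxE oppr_le0.
Qed.

Lemma reduced_laplacian_diag_ge0 (R : realType) (N : nat) (G : power_grid R N)
    (i : 'I_N) : 0 <= reduced_laplacian G i i.
Proof. by rewrite mxE eqxx sumr_ge0// => k /beta_gt0 /ltW. Qed.

Lemma reduced_laplacian_offdiag (R : realType) (N : nat) (G : power_grid R N)
    (i j : 'I_N) : i != j ->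
  reduced_laplacian G i j <= 0 ?= iff ~~ line G (Some i) (Some j).
Proof.
move=> /negbTE ij; rewrite mxE ij; case: ifP => [/beta_gt0 b0|_]; last first.
  exact/leif_refl.
by split; rewrite ?oppr_le0 ?ltW// oppr_eq0 gt_eqF.
Qed.

(* If bus [k] is neither [i] nor [j], then [H k i] and [H k j] are both
   nonpositive, so a negative summand [H k i * H k j] has [k = i] or [k = j]. *)
Lemma line_of_gram_lt0 (R : realType) (N : nat) (G : power_grid R N)
    (w : 'I_N -> R) (i j : 'I_N) : (forall k, 0 <= w k) -> i != j ->
  \sum_k w k * (reduced_laplacian G k i * reduced_laplacian G k j) < 0 ->
  line G (Some i) (Some j).
Proof.
move=> w0 ij; apply: contraTT => nline; rewrite -leNgt sumr_ge0// => k _.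
rewrite mulr_ge0//.
have [->|ki] := eqVneq k i.
  have /eqP -> : reduced_laplacian G i j == 0.
    by rewrite (reduced_laplacian_offdiag G ij).
  by rewrite mulr0.
have [->|kj] := eqVneq k j.
  have /eqP -> : reduced_laplacian G j i == 0.
    by rewrite reduced_laplacian_offdiag 1?eq_sym// line_sym.
  by rewrite mul0r.
by rewrite mulr_le0// reduced_laplacian_offdiag.
Qed.

(** * Moments of normal laws and their transfer to random variables *)

Lemma ge0_integral_normal_prob (R : realType) (m s : R) (f : R -> \bar R) :
  measurable_fun [set: R] f -> (forall x, 0 <= f x)%E ->
  (\int[normal_prob m s]_x f x =
   \int[lebesgue_measure]_x (f x * (normal_pdf m s x)%:E))%E.
Proof.
move=> mf f0; pose nu := normal_prob m s.
have numu : nu `<< lebesgue_measure := normal_prob_dominates m s.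
rewrite -(Radon_Nikodym_SigmaFinite.change_of_variables numu)//.
apply: ae_eq_integral => //.
- apply: emeasurable_funM => //; apply: measurable_int.
  exact: Radon_Nikodym_SigmaFinite.f_integrable numu.
- apply: emeasurable_funM => //; apply/measurable_EFinP.
  exact: measurable_normal_pdf.
(* The Radon-Nikodym derivative and the density have the same integral over every measurable set,
   hence agree almost everywhere. *)
apply: ae_eqe_mul2l; apply: integral_ae_eq => //.
- exact: Radon_Nikodym_SigmaFinite.f_integrable numu.
- by apply/measurable_EFinP; exact: measurable_normal_pdf.
- by move=> E _ mE; rewrite -Radon_Nikodym_SigmaFinite.f_integral.
Qed.

Lemma normal_prob_second_moment_lty (R : realType) :
  (\int[@normal_prob R 0 1]_x (x ^+ 2)%:E < +oo)%E.
Proof.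
rewrite ge0_integral_normal_prob//; last 2 first.
- by apply/measurable_EFinP; exact: measurable_funX.
- by move=> x; rewrite lee_fin sqr_ge0.
have s20 : Num.sqrt 2 != 0 :> R by rewrite gt_eqF// sqrtr_gt0.
(* Doubling the variance leaves room to absorb [x ^+ 2]; the ratio of peaks turns a bound on
   exponentials into one on densities. *)
pose C : R := 4 * (normal_peak 1 / normal_peak (Num.sqrt 2)).
have C0 : 0 <= C by rewrite !mulr_ge0 ?invr_ge0 ?normal_peak_ge0.
(* x^2 e^(-x^2/2) <= 4 e^(-x^2/4), from y <= e^y at y = x^2/4 *)
have bound x : x ^+ 2 * normal_pdf 0 1 x <= C * normal_pdf 0 (Num.sqrt 2) x.
  rewrite !normal_pdfE ?oner_eq0//.
  have peak2 : normal_peak (Num.sqrt 2) != 0 :> R.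
    by rewrite gt_eqF// normal_peak_gt0.
  rewrite (_ : C * _ = normal_peak 1 * (4 * normal_fun 0 (Num.sqrt 2) x)).
    rewrite mulrCA ler_wpM2l ?normal_peak_ge0// /normal_fun subr0 expr1n.
    rewrite sqr_sqrtr//; set y := x ^+ 2 / 4.
    have -> : - x ^+ 2 / (1 *+ 2) = - y + - y by rewrite /y; field.
    have -> : - x ^+ 2 / (2 *+ 2) = - y by rewrite /y; field.
    have -> : x ^+ 2 = 4 * y by rewrite /y; field.
    rewrite expRD -mulrA ler_pM2l// mulrA ler_piMl ?expR_ge0//.
    rewrite expRN ler_pdivrMr ?expR_gt0// mul1r.
    by apply: le_trans (expR_ge1Dx y); rewrite lerDr.
  by rewrite /C; field.
apply: (@le_lt_trans _ _
  (\int[lebesgue_measure]_x (C * normal_pdf 0 (Num.sqrt 2) x)%:E)%E).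
  apply: ge0_le_integral => //.
  - by move=> x _; rewrite -EFinM lee_fin mulr_ge0 ?sqr_ge0 ?normal_pdf_ge0.
  - apply/measurable_EFinP/measurable_funM; first exact: measurable_funX.
    exact: measurable_normal_pdf.
  - apply/measurable_EFinP/measurable_funM => //; exact: measurable_normal_pdf.
  - by move=> x _; rewrite -EFinM lee_fin.
under eq_integral do rewrite EFinM.
rewrite integralZl//; last exact: integrable_normal_pdf.
by rewrite integral_normal_pdf mule1 ltry.
Qed.

Lemma Lfun2_sqr_lty d (T : measurableType d) (R : realType)
    (mu : {measure set T -> \bar R}) (f : T -> R) :
  measurable_fun [set: T] f -> (\int[mu]_x (f x ^+ 2)%:E < +oo)%E ->
  f \in Lfun mu 2%:E.
Proof.
move=> mf f2; rewrite inE; apply/andP; split; rewrite inE//=.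
rewrite /finite_norm unlock poweR_lty//.
rewrite (eq_integral (fun x => (f x ^+ 2)%:E))// => x _ /=.
by rewrite powR_mulrn// real_normK ?num_real.
Qed.

(* [measurableTypeR R] and [R] carry the same sigma-algebra with different
   displays; [normal_prob] lives on the former, random variables on the latter. *)
Section same_law.
Context d (T : measurableType d) (R : realType) (P : probability T R).
Variables (X : T -> R) (mu : probability (measurableTypeR R) R).
Hypothesis mX : measurable_fun [set: T] X.
Hypothesis law : forall A : set R, measurable A -> P (X @^-1` A) = mu A.

Let Y : T -> measurableTypeR R := X.
Let mY : measurable_fun [set: T] Y. Proof. exact: mX. Qed.

Lemma ge0_integral_law (f : R -> \bar R) :
  measurable_fun [set: R] f -> (forall x, 0 <= f x)%E ->
  (\int[P]_w f (X w) = \int[mu]_x f x)%E.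
Proof.
move=> mf f0; transitivity (\int[pushforward P Y]_x f x)%E.
  by rewrite ge0_integral_pushforward.
by apply: (eq_measure_integral mu) => A mA _; exact: law.
Qed.

Lemma Lfun2_law : (\int[mu]_x (x ^+ 2)%:E < +oo)%E -> X \in Lfun P 2%:E.
Proof.
move=> mu2; apply: Lfun2_sqr_lty => //.
rewrite (ge0_integral_law (f := fun x => (x ^+ 2)%:E))//.
- by apply/measurable_EFinP; exact: measurable_funX.
- by move=> x; rewrite lee_fin sqr_ge0.
Qed.

Lemma variance_law : X \in Lfun P 1 ->
  ('V_P[X] = \int[mu]_x ((x - fine (\int[mu]_y y%:E)) ^+ 2)%:E)%E.
Proof.
move=> /Lfun1_integrable X1.
(* The integrand changes sign, so this transfer relies on the integrability of [X]. *)
have EX : ('E_P[X] = \int[mu]_y y%:E)%E.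
  rewrite unlock; transitivity (\int[pushforward P Y]_y y%:E)%E.
    by rewrite integral_pushforward.
  by apply: (eq_measure_integral mu) => A mA _; exact: law.
rewrite /variance unlock EX; set m := fine _.
rewrite unlock -(ge0_integral_law (f := fun x => ((x - m) ^+ 2)%:E)) => [//||x].
- apply/measurable_EFinP/measurable_funX; exact: measurable_funB.
- by rewrite lee_fin sqr_ge0.
Qed.

End same_law.

(** * Covariance of linear combinations of a Gaussian vector *)

Section gaussian_covariance.
Context d (T : measurableType d) (R : realType) (P : probability T R).
Variables (n : nat) (X : 'I_n -> {RV P >-> R}) (Sigma : 'M[R]_n).
Hypothesis gaussX : gaussian_vector X 0 Sigma.
Hypothesis Sigma_pd : forall a : 'cV[R]_n, a != 0 ->
  0 < (a^T *m Sigma *m a) 0 0.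

Let q (a b : 'cV[R]_n) : R := (a^T *m Sigma *m b) 0 0.
Let lc (a : 'cV[R]_n) (w : T) := \sum_(i < n) a i 0 * X i w.

Let measurable_lc a : measurable_fun [set: T] (lc a).
Proof.
by apply: measurable_sum => i; apply: measurable_funM.
Qed.

Let lcD a b : lc (a + b) = lc a \+ lc b.
Proof.
by apply/funext => w; rewrite /lc/= -big_split/=; apply: eq_bigr => i _;
  rewrite mxE mulrDl.
Qed.

Let lcZ k a : lc (k *: a) = k \o* lc a.
Proof.
by apply/funext => w; rewrite /lc/= mulr_suml; apply: eq_bigr => i _;
  rewrite mxE; ring.
Qed.

Let qZ k a : q (k *: a) (k *: a) = k ^+ 2 * q a a.
Proof.
by rewrite /q -scalemxAr linearZ/= -!scalemxAl scalerA mxE expr2.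
Qed.

Let lc_law a : q a a = 1 -> forall A : set R, measurable A ->
  P (lc a @^-1` A) = normal_prob 0 1 A.
Proof.
move=> qa A mA; have [_ /(_ a)[_ /(_ A mA)]] := gaussX.
rewrite -/(q a a) qa /gaussian_law ltr01 sqrtr1 mulmx0 mxE; exact.
Qed.

Let lc_std a : a != 0 ->
  exists2 b, q b b = 1 & a = Num.sqrt (q a a) *: b.
Proof.
move=> a0; have qa := Sigma_pd a0; rewrite -/(q a a) in qa.
have sq : Num.sqrt (q a a) != 0 by rewrite gt_eqF// sqrtr_gt0.
exists ((Num.sqrt (q a a))^-1 *: a); last by rewrite scalerA divff// scale1r.
by rewrite qZ exprVn sqr_sqrtr ?ltW// mulVf// gt_eqF.
Qed.

Let lc_Lfun2 a : lc a \in Lfun P 2%:E.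
Proof.
have [->|/lc_std[b qb ->]] := eqVneq a 0.
  rewrite (_ : lc 0 = cst 0) ?Lfun_cst//.
  by apply/funext => w; rewrite /lc big1// => i _; rewrite mxE mul0r.
rewrite lcZ Lfun_scale// ?ler1n//.
apply: (Lfun2_law _ (lc_law qb)) => //; exact: normal_prob_second_moment_lty.
Qed.

Lemma gaussian_vector_covariance : exists2 c : R, 0 <= c &
  forall a b : 'cV[R]_n,
    fine (covariance P (fun w => \sum_(i < n) a i 0 * X i w)
                       (fun w => \sum_(i < n) b i 0 * X i w)) =
    c * (a^T *m Sigma *m b) 0 0.
Proof.
pose V := (\int[@normal_prob R 0 1]_x
  ((x - fine (\int[@normal_prob R 0 1]_y y%:E)) ^+ 2)%:E)%E.
have P1 a : lc a \in Lfun P 1.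
  exact: Lfun_subset12 (fin_num_measure P _ measurableT) _ (lc_Lfun2 a).
have varlc a : 'V_P[lc a] = ((fine V) * q a a)%:E.
  have [->|/lc_std[b qb ->]] := eqVneq a 0.
    rewrite /q mulmx0 mxE mulr0 (_ : lc 0 = cst 0) ?variance_cst//.
    by apply/funext => w; rewrite /lc big1// => i _; rewrite mxE mul0r.
  have VE : 'V_P[lc b] = V by apply: (variance_law _ (lc_law qb)).
  (* Finiteness of [V] is inherited from the square-integrable [lc b], whose variance it is. *)
  have Vfin : V \is a fin_num by rewrite -VE variance_fin_num.
  set r := Num.sqrt _.
  by rewrite lcZ varianceZ// VE qZ qb mulr1 -{1}(fineK Vfin) -EFinM mulrC.
exists (fine V).
  by apply: fine_ge0; apply: integral_ge0 => x _; rewrite lee_fin sqr_ge0.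
move=> a b; rewrite -/(lc a) -/(lc b) -/(q a b).
have cov_fin : covariance P (lc a) (lc b) \is a fin_num.
  by rewrite covariance_fin_num// Lfun2_mul_Lfun1.
(* Polarisation: the variance of [lc (a + b)] is expanded probabilistically here and through [q]
   below; comparing the two isolates the covariance. *)
have := varianceD (lc_Lfun2 a) (lc_Lfun2 b).
rewrite -lcD !varlc -(fineK cov_fin) -EFinM -!EFinD => -[].
have -> : q (a + b) (a + b) = q a a + q b b + 2 * q a b.
  have qC : q b a = q a b.
    rewrite /q -{1}gaussX.1 -(mulmxA _ _ a) -{1}(trmxK a) -!trmx_mul.
    by rewrite mxE.
  have qDl x y z : q (x + y) z = q x z + q y z.
    by rewrite /q linearD/= !mulmxDl mxE.
  have qDr x y z : q x (y + z) = q x y + q x z by rewrite /q mulmxDr mxE.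
  by rewrite qDl !qDr qC; ring.
lra.
Qed.

End gaussian_covariance.

(** * The inverse covariance of the phase angles *)

Theorem theorem6 (d : measure_display) (T : measurableType d) (R : realType)
    (P : probability T R) (N : nat) (G : power_grid R N) (Sigma_p : 'M[R]_N)
    (p theta : 'I_N -> {RV P >-> R}) :
  radial G ->
  is_diag_mx Sigma_p ->
  (forall i : 'I_N, 0 < Sigma_p i i) ->
  gaussian_vector p 0 Sigma_p ->
  dc_power_flow G p theta ->
  forall i j : 'I_N, i != j ->
    invmx (covariance_mx theta) i j < 0 ->
    line G (Some i) (Some j).
Proof.
move=> _ /is_diag_mxP Sdiag Sgt0 gaussp flow i j ij.
set H := reduced_laplacian G.
have Hunit : H \in unitmx := reduced_laplacian_unit G.
pose s : 'rV[R]_N := \row_k Sigma_p k k.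
have SE : Sigma_p = diag_mx s.
  apply/matrixP => k l; rewrite !mxE; have [->|kl] := eqVneq; first by [].
  by rewrite Sdiag.
have Sigma_pd (a : 'cV[R]_N) : a != 0 -> 0 < (a^T *m Sigma_p *m a) 0 0.
  move=> /cV0Pn[k ak]; rewrite SE mul_mx_diag mxE.
  under eq_bigr do rewrite !mxE.
  rewrite (bigD1 k)//= ltr_pwDl//.
    by rewrite mulrAC -expr2 mulr_gt0// exprn_even_gt0.
  by apply: sumr_ge0 => l _; rewrite mulrAC -expr2 mulr_ge0 ?sqr_ge0 ?ltW.
have [c c_ge0 covp] := gaussian_vector_covariance gaussp Sigma_pd.
have thetaE k : (theta k : T -> R) =
    fun w => \sum_(l < N) (row k (invmx H))^T l 0 * p l w.
  apply/funext => w; have /(congr1 (mulmx (invmx H))) := flow w.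
  rewrite mulKmx// => /matrixP/(_ k 0); rewrite !mxE => <-.
  by apply: eq_bigr => l _; rewrite !mxE.
have covE : covariance_mx theta = c *: (invmx H *m Sigma_p *m (invmx H)^T).
  apply/matrixP => k l; rewrite mxE !thetaE covp trmxK -row_mul mxE [RHS]mxE.
  by congr (_ * _); rewrite [RHS]mxE; apply: eq_bigr => m _; rewrite !mxE.
rewrite covE.
have [->|c_neq0] := eqVneq c 0.
  (* The index [i] witnesses [0 < N], so the zero matrix is singular; [invmx] then returns it
     unchanged, and its entries are not negative. *)
  have zero_nunit : (0 : 'M[R]_N) \notin unitmx.
    rewrite -row_free_unit /row_free mxrank0.
    by rewrite ltn_eqF// (leq_ltn_trans _ (ltn_ord i)).
  by rewrite scale0r invmx_out// mxE ltxx.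
pose W := H^T *m diag_mx (\row_k (s 0 k)^-1) *m H.
have KW : (invmx H *m Sigma_p *m (invmx H)^T) *m W = 1%:M.
  rewrite trmx_inv /W !mulmxA mulmxKV ?unitmx_tr//.
  rewrite -(mulmxA (invmx H)) SE mulmx_diag.
  rewrite (_ : diag_mx _ = 1%:M) ?mulmx1 ?mulVmx//.
  rewrite -diag_const_mx; congr diag_mx; apply/rowP => k.
  by rewrite !mxE divff// gt_eqF.
have covW : c *: (invmx H *m Sigma_p *m (invmx H)^T) *m (c^-1 *: W) = 1%:M.
  by rewrite -scalemxAl -scalemxAr scalerA divff// scale1r.
(* A right inverse of a square matrix is its inverse, so [invmx] becomes [c^-1 *: W], and the
   positive factor does not affect the sign. *)
rewrite -[invmx _]mulmx1 -covW mulKmx ?(mulmx1_unit covW).1// mxE.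
rewrite pmulr_rlt0; last by rewrite invr_gt0 lt_neqAle eq_sym c_neq0.
rewrite /W mul_mx_diag mxE.
rewrite (eq_bigr (fun k => (s 0 k)^-1 * (H k i * H k j))) => [W_lt0|k _].
  apply: (line_of_gram_lt0 (w := fun k => (s 0 k)^-1) _ ij W_lt0) => k.
  by rewrite mxE invr_ge0 ltW.
by rewrite !mxE mulrAC mulrC.
Qed.
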